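(* Let $H:\mathbb R_+\to(0,1)$ be continuous and satisfy: (H1) there are constants $0<h_1<h_2<1$ with $h_1\le H_t\le h_2$ for all $t\ge0$; (H2) there are constants $D>0$, $\kappa\in(0,1]$ with $|H_t-H_s|\le D|t-s|^\kappa$ for all $t\ge s>0$; and assume $\min\{h_1,\kappa\}>1/2$. Let $Y$ be the multifractional Brownian motion with Hurst function $H$, $x_0\in\mathbb R$, and let $X$ be the solution of $X_t=x_0+\theta\int_0^tX_s\,ds+Y_t$, $t\ge0$, where the true parameter is $\theta=0$. Define \[ \hat\theta_T=\frac{\int_0^TX_s\,dX_s}{\int_0^TX_s^2\,ds}. \] Then $\hat\theta_T\to\theta=0$ in probability as $T\to\infty$.
   Context: The (harmonizable) multifractional Brownian motion with continuous functional parameter $H$ is $Y(t)=\int_{\mathbb R}\frac{e^{itu}-1}{|u|^{H_t+1/2}}\widetilde W(du)$, $t\ge0$, where $\widetilde W$ is the Fourier transform of real Gaussian white noise $W$ (the unique complex-valued random measure with $\int f\,dW=\int\widehat f\,d\widetilde W$ a.s. for all $f\in L^2(\mathbb R)$). The integral $\int_0^TX_s\,dX_s$ is the pathwise (Riemann–Stieltjes/Young-type) integral, the a.s. limit of Riemann sums, which exists since the trajectories are Hölder of order exceeding $1/2$. *)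

(* Defs.v *)
From HB Require Import structures.
From mathcomp Require Import all_boot all_order all_algebra.
From mathcomp Require Import all_classical all_reals all_analysis.
Set Implicit Arguments. Unset Strict Implicit. Unset Printing Implicit Defensive.
Import Order.TTheory GRing.Theory Num.Def Num.Theory.
Import numFieldNormedType.Exports.
Local Open Scope classical_set_scope.
Local Open Scope ring_scope.

Section defs.
Context {R : realType}.

(* Covariance of the harmonizable multifractional Brownian motion
   Y(t) = \int (e^{itu}-1)/|u|^{H_t+1/2} dW~(u), with the Fourier convention
   \hat f(u) = \int e^{-iux} f(x) dx, so that
   E[ \int f dW~ * conj(\int g dW~) ] = (1/(2 pi)) \int f(u) conj(g(u)) du.
   The real part of (e^{itu}-1)(e^{-isu}-1) is
   1 - cos(tu) - cos(su) + cos((t-s)u); the imaginary part is odd in u. *)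
Definition mBm_cov (H : R -> R) (t s : R) : R :=
  (2 * pi)^-1 *
  Rintegral lebesgue_measure setT
    (fun u : R => (1 - cos (t * u) - cos (s * u) + cos ((t - s) * u))
                  / (`|u| `^ (H t + H s + 1))).

Definition centered_gaussian_process {d} {T : measurableType d}
  (P : probability T R) (I : set R) (Y : R -> T -> R) (C : R -> R -> R) :=
  (forall t, I t -> measurable_fun setT (Y t)) /\
  forall (n : nat) (t : 'I_n -> R) (a : 'I_n -> R), (forall i, I (t i)) ->
    let v := \sum_(i < n) \sum_(j < n) a i * a j * C (t i) (t j) in
    forall B : set R, measurable B ->
      P [set w | B (\sum_(i < n) a i * Y (t i) w)] =
      (if v == 0 then \d_(0 : R) B else normal_prob 0 (Num.sqrt v) B).

Definition RS_sum (f g : R -> R) (n : nat) (t xi : nat -> R) : R :=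
  \sum_(i < n) f (xi i) * (g (t i.+1) - g (t i)).

Definition tagged_partition (a b : R) (n : nat) (t xi : nat -> R) :=
  t 0%N = a /\ t n = b /\
  forall i, (i < n)%N -> t i <= xi i <= t i.+1.

Definition mesh_lt (n : nat) (t : nat -> R) (delta : R) :=
  forall i, (i < n)%N -> t i.+1 - t i < delta.

Definition is_RS_integral (f g : R -> R) (a b I : R) :=
  forall eps, 0 < eps -> exists2 delta, 0 < delta &
    forall n t xi, tagged_partition a b n t xi -> mesh_lt n t delta ->
      `| RS_sum f g n t xi - I | < eps.

(* The pathwise integral \int_a^b f dg (an arbitrary default 0 when the
   limit of Riemann-Stieltjes sums does not exist). *)
Definition RS_integral (f g : R -> R) (a b : R) : R :=
  xget 0 [set I | is_RS_integral f g a b I].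

Definition theta_hat {T : Type} (X : R -> T -> R) (Tm : R) (w : T) : R :=
  RS_integral (fun s => X s w) (fun s => X s w) 0 Tm /
  Rintegral lebesgue_measure `[0, Tm] (fun s => X s w ^+ 2).

(* Convergence in probability of Z_T to c as T -> +oo (stated with
   measurable enclosing events, so no measurability of Z_T is presupposed). *)
Definition cvg_in_probability_at_infty {d} {T : measurableType d}
  (P : probability T R) (Z : R -> T -> R) (c : R) :=
  forall eps eta : R, 0 < eps -> 0 < eta ->
    exists T0 : R, forall Tm, T0 <= Tm ->
      exists2 A : set T, measurable A /\ [set w | eps < `| Z Tm w - c |] `<=` A
        & (P A < eta%:E)%E.

End defs.

(* Main.v *)
Require Import Defs.
From HB Require Import structures.
From mathcomp Require Import all_boot all_order all_algebra.
From mathcomp Require Import all_classical all_reals all_analysis.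
From mathcomp Require Import measurable_realfun ring lra.
Set Implicit Arguments. Unset Strict Implicit. Unset Printing Implicit Defensive.
Import Order.TTheory GRing.Theory Num.Def Num.Theory.
Import numFieldNormedType.Exports.
Local Open Scope classical_set_scope.
Local Open Scope ring_scope.

(* For theta = 0 we have X = x0 + Y.  A Riemann-Stieltjes integral of X against
   itself over [0, T], if it exists, is (X_T^2 - X_0^2) / 2, and by definition it
   is 0 otherwise; in both cases it is O_P(T^2), because Var Y_T = O(T^2).
   For the denominator, Cauchy-Schwarz gives
     (int_0^T X)^2 <= T * int_0^T X^2,
   and int_0^T X is Gaussian with variance at least of order T^(2 h1 + 2), by the
   spectral representation restricted to frequencies of order 1/T.  Hence the
   probability that int_0^T X^2 <= C T^2 is O(T^(1/2 - h1)), which tends to 0.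
   To stay with finitely many values of Y, int_0^T X is replaced by Riemann sums
   S_n, whose small ball probabilities are bounded uniformly in n, and the bad
   event is contained in liminf_n { |S_n| <= r }. *)

(** * Elementary bounds on sine and cosine *)

Lemma normr_sin_le (R : realType) (x : R) : `|sin x| <= `|x|.
Proof.
wlog x0 : x / 0 <= x.
  move=> h; have [/h//|/ltW x0] := leP 0 x.
  by rewrite -normrN -sinN -(normrN x) h// oppr_ge0.
have [c _] := @MVT_segment R sin cos 0 x x0 (fun y _ => is_derive_sin y)
  (continuous_subspaceT (@continuous_sin R)).
rewrite sin0 !subr0 => ->; rewrite normrM ler_piMl//.
by rewrite ler_norml cos_geN1 cos_le1.
Qed.

Lemma one_minus_cosE (R : realType) (x : R) :
  1 - cos x = sin (x / 2) ^+ 2 *+ 2.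
Proof.
have -> : cos x = cos ((x / 2) *+ 2) by congr cos; rewrite -mulr_natr divfK.
rewrite cos_mulr2n sin2cos2.
ring.
Qed.

Lemma one_minus_cos_le (R : realType) (x : R) : 1 - cos x <= x ^+ 2 / 2.
Proof.
have : sin (x / 2) ^+ 2 <= (x / 2) ^+ 2.
  by rewrite -(real_normK (num_real (sin _))) -(real_normK (num_real (x / 2)))
    lerXn2r ?nnegrE// normr_sin_le.
rewrite one_minus_cosE; lra.
Qed.

(** By the mean value theorem [sin x = cos c * x] with [0 < c < x <= 1] when [x] is positive, and
    [cos c >= 1 - c ^+ 2 / 2 >= 1 / 2]. *)
Lemma sin_ge_half (R : realType) (x : R) : 0 <= x <= 1 -> x / 2 <= sin x.
Proof.
move=> /andP[x0 x1].
have [c] := @MVT_segment R sin cos 0 x x0 (fun y _ => is_derive_sin y)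
  (continuous_subspaceT (@continuous_sin R)).
rewrite in_itv/= => /andP[c0 cx]; rewrite sin0 !subr0 => ->.
rewrite mulrC ler_wpM2r//.
have := one_minus_cos_le c.
have : c ^+ 2 <= 1 by rewrite expr_le1// (le_trans cx).
lra.
Qed.

(** * Integrability of the spectral density of the increments *)

(* Dominates [minr (u ^+ 2) 1 / `|u| `^ p] for [2 <= p <= 3 - b], up to a
   constant, and has on the positive half-line the bounded primitive
   [b^-1 * (u / (1 + u)) `^ b]. *)
Definition spectral_bound {R : realType} (b u : R) : R :=
  `|u| `^ (b - 1) * (1 + `|u|) `^ (- b - 1).

Section spectral_bound.
Context (R : realType).
Notation mu := (@lebesgue_measure R).

Lemma spectral_bound_ge0 (b u : R) : 0 <= spectral_bound b u.
Proof. by rewrite mulr_ge0 ?powR_ge0. Qed.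

Lemma measurable_spectral_bound (b : R) :
  measurable_fun setT (spectral_bound b).
Proof.
apply: measurable_funM;
  apply: (measurableT_comp (measurable_powR _)) => //.
exact: measurable_funD.
Qed.

(** Both terms of the product rule contain [u ^ (b - 1) * (1 + u) ^ (- b - 1)]; the remaining
    factors add up to [b * ((1 + u) - u) = b], which [b^-1] cancels. *)
Lemma is_derive_spectral_primitive (b u : R) : 0 < b -> 0 < u ->
  is_derive u 1 (fun u => b^-1 * (u `^ b * (1 + u) `^ (- b)))
    (spectral_bound b u).
Proof.
move=> b0 u0.
have u1 : 0 < 1 + u by rewrite addr_gt0.
have d1 := is_derive1_powR b u0.
have d3 : is_derive u 1 (fun u : R => 1 + u) 1.
  by have := is_deriveD (is_derive_cst (1 : R) u 1) (is_derive_id u (1 : R));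
    rewrite add0r.
have d2 := is_derive1_comp (is_derive1_powR (- b) u1) d3.
rewrite mulr1 in d2.
apply: (is_derive_eq (is_deriveZ b^-1 (is_deriveM d1 d2))).
rewrite /spectral_bound gtr0_norm// -![_ *: _]/(_ * _) /=.
rewrite -(mulr_powRB1 (ltW u0) b0).
have -> : (1 + u) `^ (- b) = (1 + u) * (1 + u) `^ (- b - 1).
  rewrite -{2}(powRr1 (ltW u1)) -powRD ?(gt_eqF u1) ?implybT//.
  by congr (_ `^ _); ring.
by field; rewrite gt_eqF.
Qed.

Lemma powR_continuous (a x : R) : 0 < x -> {for x, continuous (@powR R ^~ a)}.
Proof.
move=> x0; apply/differentiable_continuous/derivable1_diffP.
by apply: derivable_powR; rewrite in_itv/= x0.
Qed.

Lemma spectral_bound_continuous (b u : R) : u != 0 ->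
  {for u, continuous (spectral_bound b)}.
Proof.
move=> u0; apply: cvgM.
  apply: (@cvg_comp _ _ _ normr (@powR R ^~ (b - 1)) _ (nbhs `|u|)).
    exact: norm_continuous.
  by apply: powR_continuous; rewrite normr_gt0.
apply: (@cvg_comp _ _ _ (fun u : R => 1 + `|u|) (@powR R ^~ (- b - 1)) _
  (nbhs (1 + `|u|))).
  by apply: cvgD; [exact: cvg_cst|exact: norm_continuous].
by apply: powR_continuous; rewrite addr_gt0 ?normr_gt0.
Qed.

Lemma spectral_primitive_cvgy (b : R) : 0 < b ->
  b^-1 * (u `^ b * (1 + u) `^ (- b)) @[u --> +oo] --> b^-1.
Proof.
move=> b0; rewrite -[in X in _ --> X](mulr1 b^-1).
apply: cvgM; first exact: cvg_cst.
have h : (1 - (1 + u)^-1) `^ b @[u --> +oo] --> (1 - 0 : R) `^ b.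
  have h1 : 1 - (1 + u)^-1 @[u --> +oo] --> (1 - 0 : R).
    apply: cvgB; first exact: cvg_cst.
    apply/gtr0_cvgV0.
      by near=> x; rewrite addr_gt0//; near: x; exact: nbhs_pinfty_gt.
    by apply: ger_cvgy cvg_id; near=> x; rewrite lerDr.
  have h2 : {for (1 - 0 : R), continuous (@powR R ^~ b)}.
    by apply: powR_continuous; rewrite subr0.
  exact: (cvg_comp _ _ h1 h2).
rewrite subr0 powR1 in h.
apply: cvg_trans h; apply: near_eq_cvg; near=> u.
have u0 : 0 < u by near: u; exact: nbhs_pinfty_gt.
have u1 : 0 < 1 + u by rewrite addr_gt0.
have -> : 1 - (1 + u)^-1 = u * (1 + u)^-1 by field; rewrite gt_eqF.
rewrite powRM ?invr_ge0 ?ltW// -powR_inv1 ?ltW// -powRrM.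
by rewrite mulN1r.
Unshelve. all: end_near.
Qed.

Lemma integral_spectral_bound_le (b a : R) : 0 < b -> 0 < a ->
  (\int[mu]_(u in `[a, +oo[) (spectral_bound b u)%:E <= (b^-1)%:E)%E.
Proof.
move=> b0 a0.
pose F (u : R) := b^-1 * (u `^ b * (1 + u) `^ (- b)).
rewrite (@ge0_continuous_FTC2y R (spectral_bound b) F a b^-1).
- rewrite -EFinB lee_fin gerBl mulr_ge0 ?mulr_ge0 ?powR_ge0// invr_ge0 ltW//.
- by move=> x _; exact: spectral_bound_ge0.
- apply: continuous_in_subspaceT => x; rewrite inE/= in_itv/= andbT => ax.
  by apply: spectral_bound_continuous; rewrite gt_eqF// (lt_le_trans a0).
- exact: spectral_primitive_cvgy.
- move=> x ax; 
  by have [] := is_derive_spectral_primitive b0 (lt_trans a0 ax).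
- apply: cvg_at_right_filter; rewrite -/(F a).
  suff : {for a, continuous F} by [].
  apply/differentiable_continuous/derivable1_diffP.
  by have [] := is_derive_spectral_primitive b0 a0.
- move=> x; rewrite in_itv/= andbT => ax; rewrite derive1E.
  by have := is_derive_spectral_primitive b0 (lt_trans a0 ax) => -[].
Qed.

Lemma spectral_boundN (b u : R) : spectral_bound b (- u) = spectral_bound b u.
Proof. by rewrite /spectral_bound normrN. Qed.

(** The function may be unbounded at [0], so the primitive is used only on the sets [A n], which
    omit a shrinking symmetric neighbourhood of [0]. Evenness gives two equal halves, and monotone
    convergence passes to the whole line minus a null point. *)
Lemma integral_spectral_boundT_le (b : R) : 0 < b ->
  (\int[mu]_u (spectral_bound b u)%:E <= (b^-1 *+ 2)%:E)%E.
Proof.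
move=> b0.
pose a n : R := n.+1%:R^-1.
have a0 n : 0 < a n by rewrite invr_gt0.
pose A n : set R := `]-oo, (- a n)] `|` `[a n, +oo[.
have mA n : measurable (A n) by exact: measurableU.
have f0 u : (0 <= (spectral_bound b u)%:E)%E.
  by rewrite lee_fin spectral_bound_ge0.
have mf D : measurable_fun D (EFin \o spectral_bound b).
  by apply/measurable_EFinP/measurable_funTS; exact: measurable_spectral_bound.
have UA : \bigcup_n A n = ~` [set 0].
  apply/seteqP; split => u /=.
    move=> [n _] [|]; rewrite /= in_itv/= => h u0; rewrite u0 ?andbT in h.
      by rewrite oppr_ge0 leNgt a0 in h.
    by rewrite leNgt a0 in h.
  move=> /eqP; rewrite -normr_gt0 => u0.
  have [n _ /(_ _ (leqnn n))/= /ltW nu] := near_infty_natSinv_lt (PosNum u0).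
  exists n => //.
  rewrite /A/= !in_itv/= andbT lerNr.
  by apply/orP; rewrite orbC -ler_normr.
have -> : (\int[mu]_u (spectral_bound b u)%:E =
  \int[mu]_(u in \bigcup_n A n) (spectral_bound b u)%:E)%E.
  rewrite UA -[setT](setvU [set 0]) ge0_integral_setU//=; last 3 first.
  - exact: measurableC.
  - exact: mf.
  - exact/disj_setPCr.
  by rewrite integral_set1 adde0.
have nA : nondecreasing_seq A.
  move=> m n mn; have amn : a n <= a m by rewrite lef_pV2 ?posrE// ler_nat.
  apply/subsetPset; apply: setUSS => x; rewrite /= !in_itv/= ?andbT => h.
    by rewrite (le_trans h)// lerN2.
  exact: le_trans h.
have := @ge0_nondecreasing_set_cvg_integral _ _ _ _ _ mu nA mA
  (fun n => mf (A n)) (fun n u _ => f0 u).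
move=> /cvg_lim <-//; apply: lime_le.
  apply: ereal_nondecreasing_is_cvgn.
  move=> m n mn; apply: ge0_subset_integral; [exact: mA|exact: mA|exact: mf| |].
    by move=> x _; exact: f0.
  exact/subsetPset/nA.
apply: nearW => n.
rewrite /A ge0_integral_setU//=; last 2 first.
- exact: mf.
- apply/disj_setPS => x [/=]; rewrite !in_itv/= andbT => h1 h2.
  have := le_trans h2 h1; have := a0 n; lra.
rewrite ge0_integration_by_substitutionNy; last 2 first.
  apply: continuous_in_subspaceT => x; rewrite inE/= in_itv/= => xa.
  by apply: spectral_bound_continuous; rewrite lt_eqF// (le_lt_trans xa)// oppr_lt0.
  by move=> x _; exact: spectral_bound_ge0.
under eq_integral do rewrite /= spectral_boundN.
by rewrite mulr2n EFinD leeD// integral_spectral_bound_le.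
Qed.

End spectral_bound.

(** * Covariance of the multifractional Brownian motion *)

Section covariance.
Context (R : realType).
Notation mu := (@lebesgue_measure R).

(** For [v <= 1] the exponent bound [p <= 3 - b] is used together with [1 + v <= 2]; for [v > 1] it
    is [2 <= p] together with [1 + v <= 2 * v]. Either way the loss is [2 ^ (b + 1) <= 8]. *)
Lemma inv_powR_le_spectral_bound (b p v : R) : 0 < b <= 2 -> 2 <= p <= 3 - b ->
  0 < v -> minr (v ^+ 2) 1 / v `^ p <= 8 * spectral_bound b v.
Proof.
move=> /andP[b0 b2] /andP[p2 pb] v0.
have e8 : 2 `^ (b + 1) <= (8 : R).
  have -> : (8 : R) = 2 `^ 3%:R by rewrite powR_mulrn//; ring.
  by rewrite ler_powR//; lra.
rewrite /spectral_bound gtr0_norm//.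
have eN : - b - 1 = - (b + 1) by ring.
have [v1|v1] := leP v 1.
  rewrite min_l; last by rewrite expr_le1// ltW.
  have -> : v ^+ 2 / v `^ p = v `^ (2%:R - p).
    by rewrite powRB ?(gt_eqF v0) ?implybT// powR_mulrn// ltW.
  have h1 : v `^ (2%:R - p) <= v `^ (b - 1).
    by apply: ger_powR; rewrite ?v0//; lra.
  have h2 : 1 <= 8 * (1 + v) `^ (- b - 1).
    rewrite eN powRN ler_pdivlMr ?powR_gt0 ?addr_gt0// mul1r.
    apply: le_trans e8; apply: ge0_ler_powR; rewrite ?nnegrE; lra.
  by rewrite (le_trans h1)// mulrCA -[leLHS]mulr1 ler_wpM2l// powR_ge0.
rewrite min_r; last by rewrite expr_ge1// ltW.
have h1 : 1 / v `^ p <= v ^- 2.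
  rewrite div1r lef_pV2 ?posrE ?powR_gt0 ?exprn_gt0//.
  by rewrite -powR_mulrn ?(ltW v0)// ler_powR// ltW.
apply: le_trans h1 _.
have h2 : (2 * v) `^ (- b - 1) <= (1 + v) `^ (- b - 1).
  rewrite eN !powRN lef_pV2 ?posrE ?powR_gt0 ?mulr_gt0 ?addr_gt0//.
  apply: ge0_ler_powR; rewrite ?nnegrE; lra.
have h3 : v ^- 2 = v `^ (b - 1) * v `^ (- b - 1).
  rewrite -powRD ?(gt_eqF v0) ?implybT//.
  by rewrite (_ : _ + _ = - 2%:R) ?powRN ?powR_mulrn ?(ltW v0)//; ring.
rewrite h3 mulrCA ler_wpM2l ?powR_ge0//.
apply: (@le_trans _ _ (8 * (2 * v) `^ (- b - 1))); last by rewrite ler_wpM2l.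
rewrite powRM ?(ltW v0)// mulrA ler_peMl ?powR_ge0//.
by rewrite eN powRN ler_pdivlMr ?powR_gt0// mul1r.
Qed.

(** Low frequencies use the quadratic bound, high frequencies the trivial bound [2]. *)
Lemma one_minus_cos_le_min (T x u : R) : 1 <= T -> `|x| <= T ->
  1 - cos (x * u) <= 2 * T ^+ 2 * minr (`|u| ^+ 2) 1.
Proof.
move=> T1 xT; have T21 : 1 <= T ^+ 2 by rewrite exprn_ege1.
have xT2 : x ^+ 2 <= T ^+ 2.
  by rewrite -(real_normK (num_real x)) lerXn2r ?nnegrE// (le_trans _ T1).
have c0 : 0 <= 2 * T ^+ 2 by rewrite mulr_ge0// sqr_ge0.
rewrite minr_pMr// le_min; apply/andP; split.
  apply: le_trans (one_minus_cos_le _) _.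
  rewrite (real_normK (num_real u)) exprMn.
  have := ler_wpM2r (sqr_ge0 u) xT2; have := sqr_ge0 (T * u); rewrite exprMn; nra.
have := cos_geN1 (x * u); lra.
Qed.

(** The numerator is [(1 - cos (t * u)) + (1 - cos (s * u)) - (1 - cos ((t - s) * u))], and each
    bracket lies between [0] and the bound of the previous lemma. *)
Lemma cov_numerator_le (T t s u : R) : 1 <= T -> 0 <= t <= T -> 0 <= s <= T ->
  `|1 - cos (t * u) - cos (s * u) + cos ((t - s) * u)|
    <= 4 * T ^+ 2 * minr (`|u| ^+ 2) 1.
Proof.
move=> T1 /andP[t0 tT] /andP[s0 sT].
have := @one_minus_cos_le_min T t u T1; rewrite ger0_norm// => /(_ tT).
have := @one_minus_cos_le_min T s u T1; rewrite ger0_norm// => /(_ sT).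
have : `|t - s| <= T by rewrite ler_norml; lra.
move/(@one_minus_cos_le_min T (t - s) u T1).
have := cos_le1 (t * u); have := cos_le1 (s * u); have := cos_le1 ((t - s) * u).
have h : 0 <= T ^+ 2 * minr (`|u| ^+ 2) 1.
  by rewrite mulr_ge0 ?sqr_ge0// le_min ?exprn_ge0.
by rewrite ler_norml; lra.
Qed.

Definition cov_kernel (H : R -> R) (t s u : R) : R :=
  (1 - cos (t * u) - cos (s * u) + cos ((t - s) * u)) / (`|u| `^ (H t + H s + 1)).

Section cov.
Variables (H : R -> R) (h1 h2 : R).
Hypothesis h1_ge : 1 <= h1 *+ 2.
Hypothesis h2_lt : h2 < 1.
Hypothesis Hb : forall t : R, 0 <= t -> h1 <= H t <= h2.

(** The exponent [H t + H s + 1] lies in [[2, 3 - b]] for [b = 2 - 2 * h2], which dictates this [b];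
    the constant is [32 = 4 * 8]. *)
Lemma cov_kernel_le (T t s u : R) : 1 <= T -> 0 <= t <= T -> 0 <= s <= T ->
  `|cov_kernel H t s u| <= 32 * T ^+ 2 * spectral_bound (2 - 2 * h2) u.
Proof.
have h1g := h1_ge; have h2l := h2_lt.
move=> T1 tT sT; have /andP[t0 _] := tT; have /andP[s0 _] := sT.
have /andP[Ht1 Ht2] := Hb t0; have /andP[Hs1 Hs2] := Hb s0.
rewrite /cov_kernel.
(* At [u = 0] the denominator is [0], and the convention [0^-1 = 0] makes the kernel vanish. *)
have [->|u0] := eqVneq u 0.
  have p0 : H t + H s + 1 != 0.
    by rewrite gt_eqF//; lra.
  rewrite normr0 powR0// invr0 mulr0 normr0.
  by rewrite mulr_ge0 ?spectral_bound_ge0// mulr_ge0// sqr_ge0.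
have v0 : 0 < `|u| by rewrite normr_gt0.
have := @inv_powR_le_spectral_bound (2 - 2 * h2) (H t + H s + 1) `|u|.
rewrite v0 => /(_ _ _ isT) h.
have {}h : minr (`|u| ^+ 2) 1 / `|u| `^ (H t + H s + 1) <=
  8 * spectral_bound (2 - 2 * h2) `|u|.
  by apply: h; apply/andP; split; lra.
rewrite normrM normfV (ger0_norm (powR_ge0 _ _)).
apply: (@le_trans _ _ (4 * T ^+ 2 * (minr (`|u| ^+ 2) 1 / `|u| `^ (H t + H s + 1)))).
  by rewrite mulrA ler_wpM2r ?invr_ge0 ?powR_ge0// cov_numerator_le.
apply: le_trans (ler_wpM2l _ h) _; first by rewrite mulr_ge0// sqr_ge0.
by rewrite /spectral_bound normr_id; lra.
Qed.

Lemma measurable_cov_kernel (t s : R) : measurable_fun setT (cov_kernel H t s).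
Proof.
have mc (x : R) : measurable_fun setT (fun u : R => cos (x * u)).
  apply: continuous_measurable_fun => u.
  apply: (continuous_comp (f := fun u : R => x * u)); last exact: continuous_cos.
  exact: mulrl_continuous.
apply: measurable_funM.
  apply: measurable_funD => //; apply: measurable_funB => //.
  exact: measurable_funB.
under eq_fun do rewrite -powR_inv1 ?powR_ge0//.
apply: (measurableT_comp (measurable_powR _)) => //.
exact: (measurableT_comp (measurable_powR _)).
Qed.

Lemma integrable_spectral_bound (b : R) : 0 < b ->
  mu.-integrable setT (EFin \o spectral_bound b).
Proof.
move=> b0; apply/integrableP; split.
  by apply/measurable_EFinP; exact: measurable_spectral_bound.
under eq_integral do rewrite /= ger0_norm ?spectral_bound_ge0//.
exact: le_lt_trans (integral_spectral_boundT_le b0) (ltry _).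
Qed.

Lemma integrable_cov_kernel (t s : R) : 0 <= t -> 0 <= s ->
  mu.-integrable setT (EFin \o cov_kernel H t s).
Proof.
have h2l := h2_lt.
move=> t0 s0; pose T := 1 + t + s.
have b0 : 0 < 2 - 2 * h2 by lra.
apply: le_integrable (integrableZl measurableT (32 * T ^+ 2)
  (integrable_spectral_bound b0)) => //.
  by apply/measurable_EFinP; exact: measurable_cov_kernel.
move=> u _ /=; rewrite lee_fin [leRHS]ger0_norm; last first.
  by rewrite mulr_ge0 ?spectral_bound_ge0// mulr_ge0// sqr_ge0.
by apply: cov_kernel_le; rewrite /T; try (apply/andP; split); lra.
Qed.

Lemma mBm_cov_le (t : R) : 1 <= t ->
  mBm_cov H t t <= 32 / (pi * (2 - 2 * h2)) * t ^+ 2.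
Proof.
have h2l := h2_lt.
move=> t1; rewrite /mBm_cov -/(cov_kernel H t t).
have t0 : 0 <= t by lra.
have b0 : 0 < 2 - 2 * h2 by lra.
have h : Rintegral mu setT (cov_kernel H t t) <= 32 * t ^+ 2 * ((2 - 2 * h2)^-1 *+ 2).
  rewrite -lee_fin /Rintegral fineK; last first.
    by apply: integrable_fin_num => //; exact: integrable_cov_kernel.
  apply: (@le_trans _ _ (\int[mu]_u
      ((32 * t ^+ 2)%:E * (spectral_bound (2 - 2 * h2) u)%:E)%E)%E).
    apply: le_integral => //; first exact: integrable_cov_kernel.
      exact: integrableZl (integrable_spectral_bound b0).
    move=> u _; rewrite -EFinM lee_fin; apply: le_trans (ler_norm _) _.
    by apply: cov_kernel_le; rewrite ?t0/=.
  rewrite integralZl//; last exact: integrable_spectral_bound.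
  rewrite [leRHS]EFinM lee_wpmul2l ?lee_fin ?mulr_ge0 ?sqr_ge0//.
  exact: integral_spectral_boundT_le.
have pi0 := @pi_gt0 R; move: (@pi R) pi0 => p p0.
rewrite ler_pdivrMl ?mulr_gt0//; apply: le_trans h _.
by rewrite le_eqVlt; apply/orP; left; apply/eqP; field; rewrite !gt_eqF//.
Qed.

End cov.
End covariance.

(** * Lower bound on the variance of the Riemann sums of [Y] *)

Section variance_lower_bound.
Context (R : realType).
Notation mu := (@lebesgue_measure R).

(** The kernel is the real part of [phi_t * conj phi_s] with
    [phi_t = (e^{itu} - 1) / |u|^(H t + 1/2)], so the quadratic form is [|sum_i a_i phi_(t_i)|^2],
    split here into real and imaginary parts. Positivity of [H] keeps the law of exponents valid at
    [u = 0]. *)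
Lemma cov_kernel_quadratic (H : R -> R) (n : nat) (t a : 'I_n -> R) (u : R) :
  (forall i, 0 < H (t i)) ->
  \sum_(i < n) \sum_(j < n) a i * a j * cov_kernel H (t i) (t j) u =
  (\sum_(i < n) a i * (1 - cos (t i * u)) / `|u| `^ (H (t i) + 2^-1)) ^+ 2 +
  (\sum_(i < n) a i * sin (t i * u) / `|u| `^ (H (t i) + 2^-1)) ^+ 2.
Proof.
move=> H0.
have sqr_sum (g : 'I_n -> R) :
    (\sum_(i < n) g i) ^+ 2 = \sum_(i < n) \sum_(j < n) g i * g j.
  by rewrite expr2 mulr_suml; apply: eq_bigr => i _; rewrite mulr_sumr.
rewrite !sqr_sum -big_split/=; apply: eq_bigr => i _.
rewrite -big_split/=; apply: eq_bigr => j _.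
rewrite /cov_kernel mulrBl cosB.
have -> : H (t i) + H (t j) + 1 = (H (t i) + 2^-1) + (H (t j) + 2^-1) by field.
rewrite powRD; last first.
  by apply/implyP => /eqP e; have := H0 i; have := H0 j; lra.
rewrite invfM; ring.
Qed.

Section variance.
Variables (H : R -> R) (h1 h2 : R).
Hypothesis h1_ge : 1 <= h1 *+ 2.
Hypothesis h2_lt : h2 < 1.
Hypothesis Hb : forall t : R, 0 <= t -> h1 <= H t <= h2.

Let H_gt0 t : 0 <= t -> 0 < H t.
Proof.
by move=> /Hb/andP[Ht _]; apply: lt_le_trans Ht; have := h1_ge; lra.
Qed.

(** Linearity of the integral over a finite set of index pairs; integrability is recorded as well,
    so that the integral can later be restricted to a band of frequencies. *)
Lemma mBm_cov_quadratic (n : nat) (t a : 'I_n -> R) : (forall i, 0 <= t i) ->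
  \sum_(i < n) \sum_(j < n) a i * a j * mBm_cov H (t i) (t j) =
  (2 * pi)^-1 * Rintegral mu setT (fun u =>
    \sum_(i < n) \sum_(j < n) a i * a j * cov_kernel H (t i) (t j) u) /\
  mu.-integrable setT (EFin \o (fun u =>
    \sum_(i < n) \sum_(j < n) a i * a j * cov_kernel H (t i) (t j) u)).
Proof.
move=> t0.
pose f (p : 'I_n * 'I_n) u := a p.1 * a p.2 * cov_kernel H (t p.1) (t p.2) u.
have fi p : mu.-integrable setT (EFin \o f p).
  have := integrableZl measurableT (a p.1 * a p.2)
    (integrable_cov_kernel h1_ge h2_lt Hb (t0 p.1) (t0 p.2)).
  by [].
have sumE : (fun u => \sum_(i < n) \sum_(j < n) a i * a j * cov_kernel H (t i) (t j) u)
    = (fun u => \sum_p f p u).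
  by apply/funext => u; rewrite pair_big.
have i_sum : mu.-integrable setT (EFin \o (fun u => \sum_p f p u)).
  have := @integrable_sum _ _ _ mu _ measurableT _ (index_enum _) xpredT
    (fun p => EFin \o f p) (fun p _ => fi p).
  by apply: eq_integrable => // u _ /=; rewrite sumEFin.
split; last by rewrite sumE.
rewrite sumE pair_big/=.
have -> : Rintegral mu setT (fun u => \sum_p f p u) = \sum_p Rintegral mu setT (f p).
  rewrite /Rintegral; under eq_integral do rewrite -sumEFin.
  rewrite (@integral_sum _ _ _ mu _ measurableT _ (fun p => EFin \o f p) fi).
  by rewrite sum_fine// => p _; apply: integrable_fin_num => //; exact: fi.
rewrite mulr_sumr; apply: eq_bigr => p _.
rewrite /f RintegralZl//; last exact: (integrable_cov_kernel h1_ge h2_lt Hb).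
rewrite /mBm_cov -/(cov_kernel H _ _); ring.
Qed.

Lemma sum_succ (n : nat) : \sum_(i < n) i.+1%:R = n%:R * (n%:R + 1) / 2 :> R.
Proof.
elim: n => [|n ih]; first by rewrite big_ord0 mul0r mul0r.
by rewrite big_ord_recr/= ih -natr1; field.
Qed.

(* The spectral representation makes the variance the integral of a sum of two
   squares; it suffices to keep the sine square on [(2 * T)^-1 <= u <= T^-1],
   where every [sin (t i * u)] is nonnegative, so that nothing cancels. *)
Lemma riemann_variance_ge (T : R) (n : nat) : 1 <= T ->
  T `^ (2 * h1 + 2) / (256 * pi) <=
  \sum_(i < n.+1) \sum_(j < n.+1) T / n.+1%:R * (T / n.+1%:R) *
    mBm_cov H (T * i.+1%:R / n.+1%:R) (T * j.+1%:R / n.+1%:R).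
Proof.
move=> T1.
pose t (i : 'I_n.+1) := T * i.+1%:R / n.+1%:R; pose a (i : 'I_n.+1) := T / n.+1%:R.
rewrite -[leRHS]/(\sum_(i < n.+1) \sum_(j < n.+1)
  a i * a j * mBm_cov H (t i) (t j)).
have T0 : 0 < T by rewrite (lt_le_trans ltr01).
pose N : R := n.+1%:R; have N0 : 0 < N by rewrite ltr0n.
have t0 i : 0 <= t i by rewrite divr_ge0 ?mulr_ge0 ?(ltW T0) ?(ltW N0).
have tT i : t i <= T.
  by rewrite /t -mulrA ler_piMr ?(ltW T0)// ler_pdivrMr// mul1r ler_nat.
have [-> Qi] := mBm_cov_quadratic a t0.
set Q := (fun u => _) in Qi *.
have Q0 u : 0 <= Q u.
  rewrite /Q cov_kernel_quadratic; last by move=> i; exact: H_gt0.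
  by rewrite addr_ge0 ?sqr_ge0.
pose m := T `^ (2 * h1 + 3) / 64.
have Qm u : u \in `[(2 * T)^-1, T^-1] -> m <= Q u.
  rewrite in_itv/= => /andP[u1 u2].
  have u0 : 0 < u by apply: lt_le_trans u1; rewrite invr_gt0 mulr_gt0.
  have u_le1 : u <= 1 by rewrite (le_trans u2)// invf_le1.
  rewrite /Q cov_kernel_quadratic; last by move=> i; exact: H_gt0.
  apply: ler_wpDl; first exact: sqr_ge0.
  have -> : m = (T `^ (h1 + 3 / 2) / 8) ^+ 2.
    rewrite /m expr_div_n -powR_mulrn ?powR_ge0// -powRrM.
    by congr (_ `^ _ / _); field.
  (* A bound linear in [i], product of the weight [T / N], of [hsin] and of [hpow]; summing over [i]
     by [sum_succ] gives at least [T ^ (h1 + 3/2) / 8], the square root of [m]. *)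
  have term (i : 'I_n.+1) : T `^ (h1 + 3 / 2) / 4 / N ^+ 2 * i.+1%:R <=
      a i * sin (t i * u) / `|u| `^ (H (t i) + 2^-1).
    have /andP[Hi _] := Hb (t0 i).
    rewrite gtr0_norm//.
    (* From [u <= T^-1], then from [T >= 1] and [H (t i) >= h1]. *)
    have hpow : T `^ (h1 + 2^-1) <= (u `^ (H (t i) + 2^-1))^-1.
      have p0 : 0 <= H (t i) + 2^-1 by have := H_gt0 (t0 i); lra.
      rewrite -[leLHS]invrK lef_pV2 ?posrE ?invr_gt0 ?powR_gt0//.
      apply: (@le_trans _ _ (T^-1 `^ (H (t i) + 2^-1))).
        by apply: ge0_ler_powR; rewrite ?nnegrE ?invr_ge0 ?(ltW u0) ?(ltW T0).
      rewrite -powR_inv1 ?(ltW T0)// -powRrM mulN1r powRN.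
      rewrite lef_pV2 ?posrE ?powR_gt0// ler_powR//; lra.
    (* On this band [t i * u] lies between [(i + 1) / (2 * N)] and [1], where the sine is at least
       half its argument. *)
    have hsin : i.+1%:R / N / 4 <= sin (t i * u).
      have tiE : t i / (2 * T) = i.+1%:R / N / 2.
        by rewrite /t -/N; field; rewrite !gt_eqF.
      have : t i / (2 * T) <= t i * u by rewrite ler_wpM2l.
      have : t i * u / 2 <= sin (t i * u).
        apply: sin_ge_half; rewrite mulr_ge0 ?(ltW u0)//=.
        apply: (@le_trans _ _ (T * T^-1)); last by rewrite divff// gt_eqF.
        by apply: ler_pM; rewrite ?(ltW u0).
      rewrite tiE; move: (i.+1%:R / N) (sin _) => x y; lra.
    have hT : T `^ (h1 + 3 / 2) = T * T `^ (h1 + 2^-1).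
      rewrite (_ : h1 + 3 / 2 = 1 + (h1 + 2^-1)); last by field.
      by rewrite (@powRD _ T 1) ?(gt_eqF T0) ?implybT// powRr1// ltW.
    have -> : T `^ (h1 + 3 / 2) / 4 / N ^+ 2 * i.+1%:R =
        a i * (i.+1%:R / N / 4) * T `^ (h1 + 2^-1).
      by rewrite hT /a -/N; field; rewrite gt_eqF.
    have a0 : 0 <= a i by rewrite divr_ge0 ?(ltW T0).
    apply: ler_pM => //; last exact: ler_wpM2l.
      by rewrite mulr_ge0// !divr_ge0.
    exact: powR_ge0.
  apply: lerXn2r; rewrite ?nnegrE.
  - by rewrite divr_ge0 ?powR_ge0.
  - apply: sumr_ge0 => i _; apply: le_trans (term i).
    by rewrite mulr_ge0 ?divr_ge0 ?powR_ge0 ?sqr_ge0.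
  - apply: le_trans (ler_sum _ (fun i _ => term i)).
    rewrite -mulr_sumr sum_succ -/N.
    have -> : T `^ (h1 + 3 / 2) / 4 / N ^+ 2 * (N * (N + 1) / 2) =
        T `^ (h1 + 3 / 2) / 8 * (1 + N^-1) by field; rewrite gt_eqF.
    by rewrite ler_peMr ?divr_ge0 ?powR_ge0// lerDl invr_ge0 ltW.
(* The band has length [(2 * T)^-1]; with the factor [(2 * pi)^-1] of the covariance, [64] becomes
   [256 * pi]. *)
have le1 : m / (2 * T) <= Rintegral mu setT Q.
  pose J : set R := `[(2 * T)^-1, T^-1]%classic.
  have mJ : measurable J by exact: measurable_itv.
  have lJ : mu J = ((2 * T)^-1)%:E.
    rewrite /J lebesgue_measure_itv/= lte_fin ltf_pV2 ?posrE ?mulr_gt0//.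
    have -> : T < 2 * T by lra.
    by rewrite -EFinD; congr EFin; field; rewrite gt_eqF.
  have -> : m / (2 * T) = Rintegral mu J (fun=> m).
    rewrite Rintegral_cst; last exact: measurable_itv.
    by rewrite [X in fine X]lJ.
  apply: (@le_trans _ _ (Rintegral mu J Q)).
    apply: le_Rintegral => //.
      apply/integrableP; split; first by apply/measurable_EFinP; exact: measurable_cst.
      rewrite (eq_integral (cst `|m%:E|%E))// integral_cst//.
      by rewrite [X in (_ * X)%E]lJ -EFinM ltry.
    exact: integrableS Qi.
  rewrite -lee_fin /Rintegral !fineK.
  - apply: (@ge0_subset_integral _ _ _ mu J setT mJ measurableT (EFin \o Q)
      (measurable_int mu Qi)) => //.
    by move=> u _; rewrite lee_fin.
  - by apply: integrable_fin_num => //.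
  - by apply: integrable_fin_num => //; exact: integrableS Qi.
rewrite ler_pdivlMl ?mulr_gt0 ?pi_gt0//; apply: le_trans le1.
rewrite /m (_ : 2 * h1 + 3 = 2 * h1 + 2 + 1); last by ring.
rewrite (@powRD _ T _ 1) ?(gt_eqF T0) ?implybT// powRr1 ?(ltW T0)//.
have pi0 := @pi_gt0 R; move: (@pi R) pi0 => p p0.
by rewrite le_eqVlt; apply/orP; left; apply/eqP; field; rewrite !gt_eqF.
Qed.

End variance.
End variance_lower_bound.

(** * Riemann-Stieltjes and Riemann sums *)

Section riemann_sums.
Context (R : realType).
Notation mu := (@lebesgue_measure R).

Lemma telescope_nat (F : nat -> R) n : \sum_(i < n) (F i.+1 - F i) = F n - F 0%N.
Proof. by rewrite -(big_mkord xpredT (fun i => F i.+1 - F i)) telescope_sumr. Qed.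

(* Averaging the sums tagged at the left and at the right endpoints telescopes. *)
Lemma is_RS_integral_self (f : R -> R) (T I : R) : 0 <= T ->
  is_RS_integral f f 0 T I -> I = (f T ^+ 2 - f 0 ^+ 2) / 2.
Proof.
move=> T0 hI; apply/eqP; rewrite -subr_eq0 -normr_le0; apply/ler_addgt0Pl => e e0.
have [dl dl0 h] := hI e e0; rewrite addr0.
pose n := (truncn (T / dl)).+1.
have n0 : (0 : R) < n%:R by rewrite ltr0n.
pose t (i : nat) := T * i%:R / n%:R.
have tS i : t i.+1 - t i = T / n%:R.
  by rewrite /t -natr1; field; rewrite gt_eqF.
have tle i : t i <= t i.+1 by rewrite -subr_ge0 tS divr_ge0.
have t0 : t 0%N = 0 by rewrite /t mulr0 mul0r.
have tn : t n = T by rewrite /t mulfK// gt_eqF.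
have hm : mesh_lt n t dl.
  move=> i _; rewrite tS ltr_pdivrMr// -ltr_pdivrMl// mulrC.
  exact: truncnS_gt.
have h1 : `|RS_sum f f n t t - I| < e.
  by apply: h => //; split => //; split => // i _; rewrite lexx tle.
have h2 : `|RS_sum f f n t (fun i => t i.+1) - I| < e.
  by apply: h => //; split => //; split => // i _; rewrite lexx tle.
have S : RS_sum f f n t t + RS_sum f f n t (fun i => t i.+1) = f T ^+ 2 - f 0 ^+ 2.
  rewrite -tn -t0 -(telescope_nat (fun i => f (t i) ^+ 2)) -big_split/=.
  by apply: eq_bigr => i _; ring.
rewrite -S.
move: h1 h2; rewrite !ltr_norml ler_norml; lra.
Qed.

(** If the integral exists, telescoping gives its value; otherwise the default value [0] obeys any
    nonnegative bound. *)
Lemma normr_RS_integral_self (f : R -> R) (T : R) : 0 <= T ->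
  `|RS_integral f f 0 T| <= `|f T ^+ 2 - f 0 ^+ 2| / 2.
Proof.
move=> T0; rewrite /RS_integral; case: xgetP => [I -> /(is_RS_integral_self T0) ->|_].
  by rewrite normrM normfV (ger0_norm (ler0n _ 2)).
by rewrite normr0 divr_ge0.
Qed.

(** Compactness in near-covering form: a radius that works near each point of the segment yields a
    common one. *)
Lemma heine_cantor (f : R -> R) (a b e : R) : 0 < e ->
  {within `[a, b], continuous f} ->
  exists2 dl, 0 < dl & forall x y, x \in `[a, b] -> y \in `[a, b] ->
    `|x - y| < dl -> `|f x - f y| < e.
Proof.
move=> e0 cf.
pose P (dl x : R) := x \in `[a, b] -> forall y, y \in `[a, b] ->
  `|x - y| < dl -> `|f x - f y| < e.
have /compact_near_coveringP/near_covering_withinP ncov := @segment_compact R a b.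
have [x xab|dl /= dl0 hdl] := ncov R (0^'+) P _.
  have /cvgrPdist_lt/(_ (e / 2)) := (@subspace_continuousP _ _ _ f).1 cf x xab.
  rewrite divr_gt0// => /(_ isT); rewrite near_withinE => -[r /= r0 hr].
  (* Halving [r] keeps both [x'] and any [y] within [dl] of [x'] inside the ball where [f] is
     [e / 2]-close to [f x]. *)
  exists (ball x (r / 2), [set dl | dl < r / 2]) => /=.
    split; first by apply: nbhsx_ballx; rewrite divr_gt0.
    by apply: nbhs_right_lt; rewrite divr_gt0.
  move=> [x' dl]/= [xx' dlr] x'ab _ y yab x'y.
  have h1 : `|f x - f x'| < e / 2.
    by apply: hr => //; apply: lt_le_trans xx' _; lra.
  have h2 : `|f x - f y| < e / 2.
    apply: hr => //=; have d1 : `|x - x'| < r / 2 := xx'.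
    have d2 : dl < r / 2 := dlr.
    have := ler_distD x' x y; lra.
  move: h1 h2; rewrite !ltr_norml; lra.
exists (dl / 2); first by rewrite divr_gt0.
move=> x y xab yab xy.
have h : `|0 - dl / 2| < dl.
  rewrite sub0r normrN gtr0_norm ?divr_gt0//; lra.
by apply: (hdl _ h _ _ xab xab) yab xy; rewrite divr_gt0.
Qed.

Lemma Rintegral_oc_ge (f : R -> R) (a b m : R) : a <= b ->
  mu.-integrable `]a, b] (EFin \o f) -> (forall x, x \in `]a, b] -> m <= f x) ->
  m * (b - a) <= \int[mu]_(x in `]a, b]) f x.
Proof.
move=> ab fi hm.
have lab : mu `]a, b] = (b - a)%:E.
  rewrite lebesgue_measure_itv/= lte_fin.
  by move: ab; rewrite le_eqVlt => /predU1P[->|->]//; rewrite ltxx subrr.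
have -> : m * (b - a) = \int[mu]_(x in `]a, b]) m by rewrite Rintegral_cst//= lab.
apply: le_Rintegral => //.
apply/integrableP; split; first by apply/measurable_EFinP; exact: measurable_cst.
rewrite (eq_integral (cst `|m%:E|)%E)// integral_cst//= lab -EFinM ltry//.
Qed.

(** Once the cells are fine enough, [f] varies by less than [e / T] on each of the [N] cells of
    length [T / N], so each cell costs at most [e / N]. *)
Lemma riemann_sum_le (f : R -> R) (T e : R) : 0 < T -> 0 < e ->
  {within `[0, T], continuous f} ->
  \forall n \near \oo,
    \sum_(i < n.+1) T / n.+1%:R * f (T * i.+1%:R / n.+1%:R)
     <= \int[mu]_(s in `[0, T]) f s + e.
Proof.
move=> T0 e0 cf.
have [dl dl0 hdl] := @heine_cantor f 0 T (e / T) (divr_gt0 e0 T0) cf.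
have fi : mu.-integrable `[0, T] (EFin \o f).
  by apply: continuous_compact_integrable => //; exact: segment_compact.
near=> n.
pose N : R := n.+1%:R; have N0 : 0 < N by rewrite ltr0n.
pose t (i : nat) := T * i%:R / N.
have tS i : t i.+1 - t i = T / N by rewrite /t -natr1; field; rewrite gt_eqF.
have tle i : t i <= t i.+1 by rewrite -subr_ge0 tS divr_ge0 ?(ltW T0) ?(ltW N0).
have t0 i : 0 <= t i by rewrite divr_ge0 ?mulr_ge0 ?(ltW T0) ?(ltW N0).
have tT i : (i <= n.+1)%N -> t i <= T.
  by move=> iN; rewrite /t -mulrA ler_piMr ?(ltW T0)// ler_pdivrMr// mul1r ler_nat.
(* Telescoping [F] along the grid cuts the integral into half-open cells. *)
pose F x := \int[mu]_(s in `[0, x]) f s.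
have FT : F T = \sum_(i < n.+1) (F (t i.+1) - F (t i)).
  rewrite (telescope_nat (F \o t)) /= /t mulfK ?gt_eqF// mulr0 mul0r.
  by rewrite /F set_itv1 Rintegral_set1 subr0.
have eN : e = \sum_(i < n.+1) (e / N).
  by rewrite sumr_const card_ord -mulr_natr -/N divfK// gt_eqF.
rewrite -/(F T) FT [in leRHS]eN.
rewrite -big_split/=; apply: ler_sum => i _.
rewrite -/N -/(t i.+1).
have iN := ltn_ord i.
have FB : F (t i.+1) - F (t i) = \int[mu]_(s in `]t i, t i.+1]) f s.
  rewrite /F Rintegral_itvB ?bnd_simp//.
  by apply: integrableS fi => //; apply: subset_itvl; rewrite bnd_simp tT.
rewrite FB -lerBlDr.
apply: le_trans (Rintegral_oc_ge (m := f (t i.+1) - e / T) _ _ _) => //.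
- by rewrite tS; rewrite le_eqVlt; apply/orP; left; apply/eqP; field; rewrite !gt_eqF.
- apply: integrableS fi => // x /=; rewrite !in_itv/= => /andP[tx xt].
  by rewrite (le_trans (t0 i) (ltW tx)) (le_trans xt)// tT.
- move=> x; rewrite in_itv/= => /andP[tx xt].
  have : `|f (t i.+1) - f x| < e / T.
    apply: hdl.
    - by rewrite in_itv/= t0 tT.
    - by rewrite in_itv/= (le_trans (t0 i) (ltW tx)) (le_trans xt)// tT.
    - rewrite ger0_norm ?subr_ge0//; apply: (@le_lt_trans _ _ (T / N)).
        by rewrite -(tS i) lerB// ltW.
      rewrite ltr_pdivrMr// -ltr_pdivrMl// mulrC.
      apply: lt_le_trans (truncnS_gt _) _; rewrite ler_nat ltnS.
      by near: n; exact: nbhs_infty_ge.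
  by rewrite ltr_norml; lra.
Unshelve. all: end_near. Qed.

End riemann_sums.

(** * Gaussian estimates *)

Section normal_bounds.
Context (R : realType).
Notation mu := (@lebesgue_measure R).

Lemma normal_peak_le (s : R) : 0 < s -> normal_peak s <= s^-1.
Proof.
move=> s0; rewrite /normal_peak lef_pV2 ?posrE//; last first.
  by rewrite sqrtr_gt0 mulrn_wgt0// mulr_gt0 ?exprn_gt0 ?pi_gt0.
rewrite -[leLHS]ger0_norm ?(ltW s0)// -sqrtr_sqr ler_wsqrtr//.
rewrite -mulrnAr ler_peMr ?sqr_ge0//.
by have := pi_ge2 R; lra.
Qed.

(** The density never exceeds its peak, which is at most [s^-1]. *)
Lemma normal_prob_itv_le (s a b : R) : 0 < s -> a <= b ->
  (normal_prob 0 s `]a, b[ <= ((b - a) / s)%:E)%E.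
Proof.
move=> s0 ab; rewrite /normal_prob.
have lab : mu `]a, b[ = (b - a)%:E.
  rewrite lebesgue_measure_itv/= lte_fin.
  by move: ab; rewrite le_eqVlt => /predU1P[->|->]//; rewrite ltxx subrr.
apply: (@le_trans _ _ (\int[mu]_(x in `]a, b[) (s^-1)%:E)%E).
  apply: ge0_le_integral => //.
  - by move=> x _; rewrite lee_fin normal_pdf_ge0.
  - by apply/measurable_EFinP/measurable_funTS; exact: measurable_normal_pdf.
  - move=> x _; rewrite lee_fin; apply: le_trans (normal_peak_le s0).
    by rewrite normal_pdf_ub// gt_eqF.
by rewrite integral_cst// [X in (_ * X)%E]lab -EFinM mulrC.
Qed.

Lemma expRN_le (x : R) : 0 < x -> expR (- x) <= x^-1.
Proof.
move=> x0; rewrite expRN lef_pV2 ?posrE ?expR_gt0//.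
by apply: le_trans (expR_ge1Dx x); rewrite lerDr.
Qed.

(* Comparison with the density of twice the standard deviation, which is
   larger far from [0], avoids integrating a tail. *)
Lemma normal_pdf_tail_le (s l y : R) : 0 < s -> 0 < l -> l <= `|y| ->
  normal_pdf 0 s y <= 6 * (s / l) ^+ 2 * normal_pdf 0 (2 * s) y.
Proof.
move=> s0 l0 ly.
have s20 : 0 < 2 * s by rewrite mulr_gt0.
rewrite !normal_pdfE ?gt_eqF// /normal_fun subr0.
have pE : normal_peak s = 2 * normal_peak (2 * s).
  rewrite /normal_peak.
  have -> : (2 * s) ^+ 2 * pi *+ 2 = 2 ^+ 2 * (s ^+ 2 * pi *+ 2) by ring.
  rewrite sqrtrM ?sqr_ge0// sqrtr_sqr ger0_norm//.
  have : 0 < Num.sqrt (s ^+ 2 * pi *+ 2).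
    by rewrite sqrtr_gt0 mulrn_wgt0// mulr_gt0 ?exprn_gt0 ?pi_gt0.
  by move: (Num.sqrt _) => q q0; field; rewrite gt_eqF.
have y2 : l ^+ 2 <= y ^+ 2.
  rewrite -(real_normK (num_real y)) lerXn2r ?nnegrE ?(ltW l0)//.
have y20 : 0 < y ^+ 2 by rewrite (lt_le_trans _ y2)// exprn_gt0.
have -> : - y ^+ 2 / (s ^+ 2 *+ 2) =
    - (3 * y ^+ 2 / (8 * s ^+ 2)) + - y ^+ 2 / ((2 * s) ^+ 2 *+ 2).
  by field; rewrite gt_eqF.
rewrite expRD pE.
(* The excess exponent is bounded through [exp (- x) <= x^-1], with [8 / 3 <= 3]; the ratio [2] of
   the peaks then turns [3] into [6]. *)
have h : expR (- (3 * y ^+ 2 / (8 * s ^+ 2))) <= 3 * (s / l) ^+ 2.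
  apply: le_trans (expRN_le _) _.
    by apply: divr_gt0; apply: mulr_gt0 => //; rewrite exprn_gt0.
  rewrite invf_div expr_div_n ler_pdivrMr; last first.
    by rewrite mulr_gt0.
  have -> : 3 * (s ^+ 2 / l ^+ 2) * (3 * y ^+ 2) = 9 * s ^+ 2 * (y ^+ 2 / l ^+ 2).
    by field; rewrite gt_eqF.
  apply: (@le_trans _ _ (9 * s ^+ 2 * 1)).
    by have := sqr_ge0 s; lra.
  apply: ler_wpM2l; first by rewrite mulr_ge0 ?sqr_ge0.
  by rewrite ler_pdivlMr ?exprn_gt0// mul1r.
have := normal_peak_ge0 (2 * s); have := expR_ge0 (- y ^+ 2 / ((2 * s) ^+ 2 *+ 2)).
move: (expR (- y ^+ 2 / _)) (normal_peak _) => e p e0 p0.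
have := ler_wpM2l (mulr_ge0 p0 e0) h.
move: (expR _) (s / l) => E q; nra.
Qed.

(** A Chebyshev-type bound: the comparison density has total mass [1]. *)
Lemma normal_prob_tail_le (s l : R) : 0 < s -> 0 < l ->
  (normal_prob 0 s [set y : R | (l < `|y|)%R] <= (6 * (s / l) ^+ 2)%:E)%E.
Proof.
move=> s0 l0; rewrite /normal_prob.
have mB : measurable [set y : R | l < `|y|].
  rewrite -[X in measurable X]setTI.
  have := @normr_measurable R setT measurableT _ (measurable_itv `]l, +oo[).
  by rewrite set_itvoy.
have s20 : 2 * s != 0 by rewrite gt_eqF// mulr_gt0.
have mpdf t D : measurable_fun D (EFin \o normal_pdf 0 t : R -> \bar R).
  by apply/measurable_EFinP/measurable_funTS; exact: measurable_normal_pdf.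
have k0 : 0 <= 6 * (s / l) ^+ 2 by rewrite mulr_ge0// sqr_ge0.
set B := (X in measurable X) in mB.
apply: (@le_trans _ _ (\int[mu]_(y in B)
    ((6 * (s / l) ^+ 2)%:E * (normal_pdf 0 (2 * s) y)%:E))%E).
  apply: ge0_le_integral => //.
  - by move=> x _; rewrite lee_fin normal_pdf_ge0.
  - exact: mpdf.
  - by apply: emeasurable_funM => //; exact: mpdf.
  - move=> x /= lx; rewrite -EFinM lee_fin; apply: normal_pdf_tail_le => //.
    exact: ltW.
rewrite ge0_integralZl//; last 2 first.
- exact: mpdf.
- by move=> x _; rewrite lee_fin normal_pdf_ge0.
rewrite -[leRHS]mule1 lee_wpmul2l ?lee_fin//.
rewrite -(@integral_normal_pdf R 0 (2 * s)).
apply: (@ge0_subset_integral _ _ _ mu B setT mB measurableT _ (mpdf _ _)) => //.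
by move=> x _; rewrite lee_fin normal_pdf_ge0.
Qed.
End normal_bounds.

(** * Pathwise control of Riemann sums on the bad event *)

Section path_and_process.
Context (R : realType).
Notation mu := (@lebesgue_measure R).

(** Cauchy-Schwarz, from the nonnegativity of the sum of squared deviations from the mean
    [S / N]. *)
Lemma sqr_sum_le (n : nat) (x : 'I_n -> R) :
  (\sum_(i < n) x i) ^+ 2 <= n%:R * \sum_(i < n) x i ^+ 2.
Proof.
case: n x => [|n] x; first by rewrite !big_ord0 expr0n mul0r.
set N : R := n.+1%:R; have N0 : 0 < N by rewrite ltr0n.
set S := \sum_i x i.
have : 0 <= \sum_i (x i - S / N) ^+ 2 by apply: sumr_ge0 => i _; exact: sqr_ge0.
have -> : \sum_i (x i - S / N) ^+ 2 = \sum_i x i ^+ 2 - S ^+ 2 / N.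
  under eq_bigr do rewrite sqrrB.
  rewrite !big_split/= sumrN sumr_const card_ord sumrMnl -mulr_suml -/S.
  by rewrite -mulr_natr -/N; field; rewrite gt_eqF.
by rewrite subr_ge0 ler_pdivrMr// mulrC.
Qed.

(** Deterministic core: a large quotient with a controlled increment forces the integral of [x ^+ 2]
    to be [O(T ^+ 2)], hence, by Cauchy-Schwarz, the Riemann sums of [x] to be eventually
    [O(T ^ (3/2))]. *)
Lemma path_riemann_sum_le (x : R -> R) (T L eps : R) : 1 <= T -> 0 < L -> 0 < eps ->
  {within `[0, T], continuous x} -> `|x T - x 0| <= L * T ->
  eps < `|RS_integral x x 0 T / \int[mu]_(s in `[0, T]) x s ^+ 2| ->
  \forall n \near \oo,
    `|\sum_(i < n.+1) T / n.+1%:R * x (T * i.+1%:R / n.+1%:R)|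
      <= Num.sqrt ((L ^+ 2 + 2 * `|x 0| * L) / eps * T ^+ 3).
Proof.
move=> T1 L0 e0 cx xL.
have T0 : 0 < T by rewrite (lt_le_trans ltr01).
set I := \int[mu]_(s in _) _; set K := L ^+ 2 + 2 * `|x 0| * L => heps.
have I0 : 0 <= I by apply: Rintegral_ge0 => s _; exact: sqr_ge0.
(* If [I = 0], the quotient is [0] by convention and cannot exceed [eps]. *)
have Ipos : 0 < I.
  rewrite lt_neqAle I0 andbT; apply/negP => /eqP I0'.
  by move: heps; rewrite -I0' invr0 mulr0 normr0 ltNge ltW.
have K0 : 0 < K by rewrite ltr_wpDr ?exprn_gt0// !mulr_ge0// ltW.
have IK : I <= K * T ^+ 2 / 2 / eps.
  rewrite ler_pdivlMr// mulrC.
  rewrite normrM normfV (ger0_norm I0) ltr_pdivlMr// in heps.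
  apply: le_trans (ltW heps) _.
  apply: le_trans (normr_RS_integral_self x (ltW T0)) _.
  rewrite ler_wpM2r ?invr_ge0//.
  have -> : x T ^+ 2 - x 0 ^+ 2 = (x T - x 0) * ((x T - x 0) + 2 * x 0) by ring.
  rewrite normrM.
  have h : `|x T - x 0 + 2 * x 0| <= L * T + 2 * `|x 0| * T.
    apply: le_trans (ler_normD _ _) _; apply: lerD => //.
    by rewrite normrM ger0_norm// ler_peMr// mulr_ge0.
  apply: le_trans (ler_pM (normr_ge0 _) (normr_ge0 _) xL h) _.
  by rewrite /K le_eqVlt; apply/orP; left; apply/eqP; ring.
have cx2 : {within `[0, T], continuous (fun s => x s ^+ 2)}.
  move=> s; apply: (@continuous_comp _ _ _ (x : subspace _ -> R) (fun y => y ^+ 2)).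
    exact: cx.
  exact: exprn_continuous.
(* The discretization error is allowed to be as large as the bound [IK] itself, which absorbs the
   factor [1 / 2]. *)
have e'0 : 0 < K * T ^+ 2 / 2 / eps by rewrite !divr_gt0 ?mulr_gt0 ?exprn_gt0.
have := riemann_sum_le T0 e'0 cx2; apply: filterS => n hn.
set N : R := n.+1%:R; have N0 : 0 < N by rewrite ltr0n.
rewrite -sqrtr_sqr ler_wsqrtr// -mulr_sumr exprMn.
apply: (@le_trans _ _ ((T / N) ^+ 2 * (N * \sum_(i < n.+1) x (T * i.+1%:R / N) ^+ 2))).
  by rewrite ler_wpM2l ?sqr_ge0// sqr_sum_le.
rewrite -mulr_sumr -/N in hn.
have -> : (T / N) ^+ 2 * (N * \sum_(i < n.+1) x (T * i.+1%:R / N) ^+ 2) =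
    T * (T / N * \sum_(i < n.+1) x (T * i.+1%:R / N) ^+ 2).
  by field; rewrite gt_eqF.
apply: le_trans (ler_wpM2l (ltW T0) hn) _.
apply: le_trans (ler_wpM2l (ltW T0) (lerD IK (lexx _))) _.
by rewrite le_eqVlt; apply/orP; left; apply/eqP; field; rewrite gt_eqF.
Qed.

Lemma mBm_cov_ge0 (H : R -> R) (t : R) : 0 <= mBm_cov H t t.
Proof.
rewrite /mBm_cov mulr_ge0 ?invr_ge0 ?mulr_ge0 ?pi_ge0//.
apply: Rintegral_ge0 => u _; rewrite divr_ge0 ?powR_ge0// subrr mul0r cos0.
by have := cos_le1 (t * u); lra.
Qed.

(** * Limit inferior of events and Gaussian estimates for the process *)

Section prob.
Context {d : measure_display} {T : measurableType d} (P : probability T R).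

Lemma measurable_liminf (E : (set T)^nat) : (forall n, measurable (E n)) ->
  measurable (\bigcup_m \bigcap_(n in [set n | (m <= n)%N]) E n).
Proof.
by move=> mE; apply: bigcup_measurable => m _; apply: bigcap_measurableType.
Qed.

(** The tail intersections increase and the one from [m] on lies in [E m]; continuity from below
    preserves the uniform bound. *)
Lemma probability_liminf_le (E : (set T)^nat) (b : \bar R) :
  (forall n, measurable (E n)) -> (forall n, P (E n) <= b)%E ->
  (P (\bigcup_m \bigcap_(n in [set n | (m <= n)%N]) E n) <= b)%E.
Proof.
move=> mE Eb.
pose F m := \bigcap_(n in [set n | (m <= n)%N]) E n.
have mF m : measurable (F m) by apply: bigcap_measurableType.
have FP : P \o F @ \oo --> P (\bigcup_m F m).
  apply: nondecreasing_cvg_mu => //.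
    exact: measurable_liminf.
  move=> m n mn; apply/subsetPset => w Fw k /= nk.
  by apply: Fw => /=; exact: leq_trans nk.
rewrite -/F -(cvg_lim _ FP)//; apply: lime_le; first exact/cvgP/FP.
apply: nearW => m; apply: le_trans (Eb m).
by apply: le_measure; rewrite ?inE// => w; apply => /=.
Qed.

Variables (I : set R) (Y : R -> T -> R) (C : R -> R -> R).
Hypothesis gY : centered_gaussian_process P I Y C.

Lemma gaussian_marginal (t : R) (B : set R) : I t -> measurable B ->
  P [set w | B (Y t w)] =
  if C t t == 0 then \d_(0 : R) B else normal_prob 0 (Num.sqrt (C t t)) B.
Proof.
move=> It mB; have := gY.2 1%N (fun=> t) (fun=> 1) (fun=> It).
rewrite /= !big_ord1 !mul1r => /(_ B mB) <-.
by congr (P _); apply/seteqP; split => w /=; rewrite big_ord1 mul1r.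
Qed.

Lemma gaussian_tail_le (t l : R) : I t -> 0 <= C t t -> 0 < l ->
  (P [set w | (l < `|Y t w|)%R] <= (6 * (C t t / l ^+ 2))%:E)%E.
Proof.
move=> It C0 l0.
have mB : measurable [set y : R | l < `|y|].
  rewrite -[X in measurable X]setTI.
  have := @normr_measurable R setT measurableT _ (measurable_itv `]l, +oo[).
  by rewrite set_itvoy.
have -> := gaussian_marginal It mB.
have [->|Cn0] := eqVneq (C t t) 0.
  (* With zero variance the law is the Dirac mass at [0], which does not charge the tail. *)
  rewrite mul0r mulr0 diracE memNset//= normr0; apply/negP.
  by rewrite -leNgt ltW.
have s0 : 0 < Num.sqrt (C t t) by rewrite sqrtr_gt0 lt_neqAle eq_sym Cn0.
by apply: le_trans (normal_prob_tail_le s0 l0) _; rewrite expr_div_n sqr_sqrtr.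
Qed.

(** Only the length of the interval enters, so it may be off centre; this accommodates the drift
    [x0 * T] in the Riemann sums of [X]. *)
Lemma gaussian_small_ball_le (n : nat) (t a : 'I_n -> R) (l r v : R) :
  (forall i, I (t i)) -> l <= r -> 0 < v ->
  v ^+ 2 <= \sum_(i < n) \sum_(j < n) a i * a j * C (t i) (t j) ->
  (P [set w | (l < \sum_(i < n) a i * Y (t i) w < r)%R] <= ((r - l) / v)%:E)%E.
Proof.
move=> It lr v0 vV.
have := gY.2 n t a It.
set V := \sum_(i < n) _ in vV *; move=> /(_ `]l, r[%classic (measurable_itv _)).
have V0 : 0 < V by rewrite (lt_le_trans _ vV)// exprn_gt0.
rewrite gt_eqF// set_itvE => ->; rewrite -set_itvE.
have s0 : 0 < Num.sqrt V by rewrite sqrtr_gt0.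
apply: le_trans (normal_prob_itv_le s0 lr) _.
rewrite lee_fin ler_wpM2l ?subr_ge0// lef_pV2 ?posrE//.
by rewrite -[leLHS]ger0_norm ?(ltW v0)// -sqrtr_sqr ler_wsqrtr.
Qed.

End prob.
End path_and_process.

(** * Convergence in probability, by enclosing the deviation in three unlikely events *)

Theorem theorem12 (R : realType) (d : measure_display) (Omega : measurableType d)
  (P : probability Omega R)
  (H : R -> R) (h1 h2 D kappa : R)
  (Y X : R -> Omega -> R) (x0 theta : R) :
  {within `[0, +oo[, continuous H} ->
  (forall t, 0 <= t -> 0 < H t < 1) ->
  0 < h1 -> h1 < h2 -> h2 < 1 ->
  (forall t, 0 <= t -> h1 <= H t <= h2) ->
  0 < D -> 0 < kappa -> kappa <= 1 ->
  (forall t s, 0 < s -> s <= t -> `|H t - H s| <= D * (t - s) `^ kappa) ->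
  2^-1 < Num.min h1 kappa ->
  (* Y is the (continuous version of the) multifractional Brownian motion *)
  centered_gaussian_process P `[0, +oo[ Y (mBm_cov H) ->
  (forall w, {within `[0, +oo[, continuous (fun t => Y t w)}) ->
  (* X solves X_t = x0 + theta \int_0^t X_s ds + Y_t, with theta = 0 *)
  theta = 0 ->
  (forall w t, 0 <= t ->
     X t w = x0 + theta * Rintegral lebesgue_measure `[0, t] (fun s => X s w)
             + Y t w) ->
  cvg_in_probability_at_infty P (theta_hat X) theta.
Proof.
move=> _ _ _ _ h2_lt Hb _ _ _ _ hmin gY cY -> hX.
have h1g : 2^-1 < h1 by move: hmin; rewrite lt_min => /andP[].
have h1_ge : 1 <= h1 *+ 2 by lra.
have XE t w : 0 <= t -> X t w = x0 + Y t w by move=> /(hX w) ->; rewrite mul0r addr0.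
have mY t : 0 <= t -> measurable_fun setT (Y t).
  by move=> t0; apply: gY.1; rewrite /= in_itv/= t0.
move=> eps eta e0 eta0.
pose c := 32 / (pi * (2 - 2 * h2)) : R.
have c0 : 0 < c by rewrite divr_gt0// mulr_gt0 ?pi_gt0//; lra.
(* Since [L >= 1], [L ^+ 2 >= L >= 24 * c / eta], so that [|Y T| > L * T] has probability at most
   [eta / 4]. *)
pose L := 1 + 24 * c / eta.
have L1 : 1 <= L.
  rewrite lerDl; apply: divr_ge0; last exact: ltW.
  by apply: mulr_ge0 => //; exact: ltW.
have L0 : 0 < L by rewrite (lt_le_trans ltr01).
have hL : 6 * (c / L ^+ 2) <= eta / 4.
  rewrite mulrA ler_pdivrMr ?exprn_gt0//.
  apply: (@le_trans _ _ (eta / 4 * L)); last first.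
    rewrite ler_wpM2l ?divr_ge0 ?(ltW eta0)//.
    by rewrite expr2 ler_peMr// ltW.
  rewrite (_ : eta / 4 * L = eta / 4 + 6 * c); last by rewrite /L; field; rewrite gt_eqF.
  by rewrite lerDr divr_ge0// ltW.
pose K := L ^+ 2 + 2 * `|x0| * L.
have K0 : 0 < K by rewrite ltr_wpDr ?exprn_gt0// !mulr_ge0// ltW.
(* The variance bound [V] is of order [T ^ (q + 3)] and [r ^+ 2] of order [T ^ 3]; [h1 > 1/2] makes
   [q] positive, and [M] is the value [T ^ q] must reach for [hrV]. *)
pose q := 2 * h1 - 1; have q0 : 0 < q by rewrite /q; lra.
pose M := 256 * (256 * pi) * (K / eps) / eta ^+ 2.
have M0 : 0 <= M by rewrite !mulr_ge0 ?invr_ge0 ?pi_ge0 ?sqr_ge0 ?(ltW K0) ?(ltW e0).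
exists (Num.max 1 (M `^ q^-1)) => T; rewrite ge_max => /andP[T1 TM].
have T0 : 0 < T by rewrite (lt_le_trans ltr01).
have {}TM : M <= T `^ q.
  have -> : M = (M `^ q^-1) `^ q.
    by rewrite -powRrM mulVf ?gt_eqF// powRr1.
  by apply: ge0_ler_powR => //; rewrite ?nnegrE ?powR_ge0// ltW.
pose r := Num.sqrt (K / eps * T ^+ 3).
have r0 : 0 < r by rewrite sqrtr_gt0 !mulr_gt0 ?invr_gt0// exprn_gt0.
pose V := T `^ (2 * h1 + 2) / (256 * pi).
have V0 : 0 < V by rewrite divr_gt0 ?powR_gt0 ?mulr_gt0 ?pi_gt0.
have hrV : (2 * r - - (2 * r)) / Num.sqrt V <= eta / 4.
  rewrite opprK (_ : 2 * r + 2 * r = 4 * r); last by ring.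
  rewrite ler_pdivrMr ?sqrtr_gt0//.
  have -> : 4 * r = Num.sqrt (16 * (K / eps * T ^+ 3)).
    rewrite (_ : 16 = 4 ^+ 2); last by ring.
    by rewrite sqrtrM ?sqr_ge0// sqrtr_sqr ger0_norm.
  have -> : eta / 4 = Num.sqrt ((eta / 4) ^+ 2).
    by rewrite sqrtr_sqr ger0_norm// divr_ge0// ltW.
  rewrite -sqrtrM ?sqr_ge0// ler_wsqrtr//.
  have -> : V = T `^ q * T ^+ 3 / (256 * pi).
    rewrite /V -powR_mulrn ?(ltW T0)// -powRD ?(gt_eqF T0) ?implybT//.
    by congr (_ `^ _ / _); rewrite /q; ring.
  move: (@pi_gt0 R) TM; rewrite /M; move: (@pi R) => p p0 TM.
  apply: (@le_trans _ _ ((eta / 4) ^+ 2 * (256 * (256 * p) * (K / eps) / eta ^+ 2 *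
      T ^+ 3 / (256 * p)))).
    by rewrite le_eqVlt; apply/orP; left; apply/eqP; field; rewrite !gt_eqF.
  apply: ler_wpM2l; first exact: sqr_ge0.
  apply: ler_wpM2r; first by rewrite invr_ge0 mulr_ge0// ltW.
  by apply: ler_wpM2r; first by rewrite exprn_ge0// ltW.
pose S n w := \sum_(i < n.+1) T / n.+1%:R * Y (T * i.+1%:R / n.+1%:R) w.
have tn0 n (i : 'I_n.+1) : 0 <= T * i.+1%:R / n.+1%:R.
  by rewrite divr_ge0 ?mulr_ge0// ltW.
(* This says [|x0 * T + S n w| < 2 * r]; doubling [r] makes the inequality strict, as the small ball
   estimate concerns open intervals. *)
pose E n := [set w | - (2 * r) - x0 * T < S n w < 2 * r - x0 * T].
have mS n : measurable_fun setT (S n).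
  apply: measurable_sum => i; apply: measurable_funM => //.
  exact/mY/tn0.
have mE n : measurable (E n).
  have := mS n measurableT _ (measurable_itv `]- (2 * r) - x0 * T, 2 * r - x0 * T[).
  by rewrite setTI set_itvE.
have PE n : (P (E n) <= (eta / 4)%:E)%E.
  apply: (@le_trans _ _ ((2 * r - x0 * T - (- (2 * r) - x0 * T)) / Num.sqrt V)%:E).
    apply: (gaussian_small_ball_le gY
      (t := fun i : 'I_n.+1 => T * i.+1%:R / n.+1%:R)
      (a := fun i : 'I_n.+1 => T / n.+1%:R)).
    - by move=> i; rewrite /= in_itv/= tn0.
    - rewrite lerD2r; apply: (@le_trans _ _ 0); last by rewrite mulr_ge0// ltW.
      by rewrite oppr_le0 mulr_ge0// ltW.
    - by rewrite sqrtr_gt0.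
    - rewrite sqr_sqrtr ?(ltW V0)//.
      exact: (riemann_variance_ge h1_ge h2_lt Hb).
  rewrite lee_fin; apply: le_trans hrV.
  by rewrite opprB addrA subrK.
pose A0 := [set w | Y 0 w != 0].
pose A1 := [set w | L * T < `|Y T w|].
pose A2 := \bigcup_m \bigcap_(n in [set n | (m <= n)%N]) E n.
have mA0 : measurable A0.
  have := mY 0 (lexx _) measurableT _ (measurableC (measurable_set1 0)).
  rewrite setTI; congr (measurable _).
  by apply/seteqP; split => w /= /eqP.
have mA1 : measurable A1.
  have := measurableT_comp (@normr_measurable R setT) (mY T (ltW T0))
    measurableT (measurable_itv `]L * T, +oo[).
  by rewrite setTI set_itvoy.
have mA2 : measurable A2 by exact: measurable_liminf.
(* The covariance vanishes at time [0], so the law of [Y 0] is the Dirac mass at [0]. *)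
have PA0 : P A0 = 0%E.
  have I0 : [set` `[0, +oo[%R] (0 : R) by rewrite /= in_itv/= lexx.
  have -> : A0 = [set w | (~` [set 0]) (Y 0 w)].
    by apply/seteqP; split => w /= /eqP.
  rewrite (gaussian_marginal gY I0 (measurableC (measurable_set1 0))).
  have -> : mBm_cov H 0 0 = 0.
    rewrite /mBm_cov (@eq_Rintegral _ _ _ _ _ (fun=> 0)) ?Rintegral_cst// ?mul0r ?mulr0//.
    by move=> u _; rewrite subrr !mul0r cos0 subrr sub0r addNr mul0r.
  by rewrite eqxx diracE memNset//= => /(_ erefl).
have PA1 : (P A1 <= (eta / 4)%:E)%E.
  have It : [set` `[0, +oo[%R] T by rewrite /= in_itv/= ltW.
  apply: le_trans (gaussian_tail_le gY It (mBm_cov_ge0 H T) _) _.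
    by rewrite mulr_gt0.
  rewrite lee_fin; apply: le_trans hL.
  rewrite ler_wpM2l// ler_pdivrMr ?exprn_gt0 ?mulr_gt0//.
  apply: le_trans (mBm_cov_le h1_ge h2_lt Hb T1) _; rewrite -/c.
  by rewrite le_eqVlt; apply/orP; left; apply/eqP; field; rewrite gt_eqF.
have PA2 : (P A2 <= (eta / 4)%:E)%E by exact: probability_liminf_le.
exists (A0 `|` A1 `|` A2); last first.
  apply: (@le_lt_trans _ _ (0 + (eta / 4)%:E + (eta / 4)%:E)%E).
    apply: le_trans (measureU2 P (measurableU _ _ mA0 mA1) mA2) _.
    apply: leeD PA2; apply: le_trans (measureU2 P mA0 mA1) _.
    by apply: leeD PA1; have : (P A0 <= 0)%E by rewrite PA0.
  by rewrite add0e -EFinD lte_fin; lra.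
split; first by apply: measurableU => //; exact: measurableU.
move=> w /=; rewrite subr0 /theta_hat => hw.
(* Outside [A0] and [A1] the path starts at [x0] and its increment is at most [L * T], so the
   pathwise estimate puts [w] in [A2]. *)
have [Y0|Y0] := eqVneq (Y 0 w) 0; last by left; left.
have [YT|YT] := leP `|Y T w| (L * T); last by left; right.
right.
have X0 : X 0 w = x0 by rewrite XE// Y0 addr0.
have cX : {within `[0, T], continuous (fun s => X s w)}.
  apply: (@subspace_eq_continuous _ _ _ (fun s => x0 + Y s w) (X ^~ w)).
    by move=> s; rewrite inE/= in_itv/= => /andP[s0 _] /=; rewrite (XE _ _ s0).
  have cYT : {within `[0, T], continuous (fun s => Y s w)}.
    by apply: continuous_subspaceW (cY w); apply: subset_itvl.
  by move=> s; apply: cvgD; [exact: cvg_cst|exact: cYT].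
have XT : `|X T w - X 0 w| <= L * T.
  by rewrite X0 XE ?(ltW T0)// addrC addKr.
have [m _ hm] := path_riemann_sum_le T1 L0 e0 cX XT hw.
exists m => // n /= mn; have := hm n mn; rewrite /= X0 -/K -/r.
have -> : \sum_(i < n.+1) T / n.+1%:R * X (T * i.+1%:R / n.+1%:R) w = x0 * T + S n w.
  under eq_bigr do rewrite XE// mulrDr.
  rewrite big_split/= -/(S n w) sumr_const card_ord; congr (_ + _).
  have : n.+1%:R != 0 :> R by rewrite pnatr_eq0.
  by rewrite -[LHS]mulr_natr; move: n.+1%:R => N N0; field.
rewrite ler_norml /E/=; lra.
Qed.
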